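(* Let $K$ be a field of characteristic zero, let $P\in K[x]$ be a polynomial, and let $E$ be the splitting field of $P$ over $K$. If the equation $P(x)=0$ over $K$ is solvable by radicals, then the Galois group $G(E,K)$ is a solvable group.
   Context: All fields have characteristic zero. For a splitting field $E$ of a polynomial over $K$, the Galois group $G(E,K)$ is the group of all field automorphisms of $E$ that fix every element of $K$. A chain of radical extensions of $K$ is a chain of field extensions $K=R_0\subset R_1\subset\dots\subset R_n$ such that for each $i=1,\dots,n$ the field $R_i$ is obtained from $R_{i-1}$ by adjoining an element $a_i$ with $a_i^{k_i}\in R_{i-1}$ for some natural number $k_i\ge 1$. The equation $P(x)=0$ over $K$ is solvable by radicals if there exist a chain of radical extensions $K=R_0\subset R_1\subset\dots\subset R_n$ and a field homomorphism $\pi:E\to R_n$, where $E$ is the splitting field of $P$ over $K$, such that the restriction of $\pi$ to $K$ is the identity map. *)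

(* Defs.v *)
From mathcomp Require Import all_boot all_order all_algebra all_fingroup.
From mathcomp Require Import all_solvable all_field.

Set Implicit Arguments.
Unset Strict Implicit.
Unset Printing Implicit Defensive.

Import GRing.Theory.
Local Open Scope ring_scope.

(* The base field K is 1%AS inside an extension, via a |-> a%:A. *)
Definition splitting_field (K : fieldType) (P : {poly K})
    (E : fieldExtType K) : Prop :=
  splittingFieldFor 1%AS (map_poly (in_alg E) P) {:E}%AS.

Definition radical_step (K : fieldType) (L : fieldExtType K)
    (F F' : {subfield L}) : Prop :=
  exists (a : L) (k : nat),
    [/\ (0 < k)%N, a ^+ k \in F & F' = <<F; a>>%AS].

(* The chain is K = R 0, R 1, ..., R n = L; the values R i for i > n are
   irrelevant.  Taking the top field L to be a finite extension of K loses no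
   generality: each a_i is a root of 'X^(k_i) - (a_i ^+ k_i)%:P over R (i-1),
   so the top of any chain of radical extensions has finite degree over K. *)
Definition radical_chain (K : fieldType) (L : fieldExtType K) (n : nat)
    (R : nat -> {subfield L}) : Prop :=
  [/\ R 0%N = 1%AS, R n = {:L}%AS
    & forall i : nat, (i < n)%N -> radical_step (R i) (R i.+1)].

(* Solvability by radicals of an equation P(x) = 0 depends on P only through
   its splitting field, which is the argument E here. *)
Definition solvable_by_radicals (K : fieldType) (E : fieldExtType K) : Prop :=
  exists (L : fieldExtType K) (n : nat) (R : nat -> {subfield L})
         (pi : {rmorphism E -> L}),
    radical_chain n R /\ (forall c : K, pi c%:A = c%:A).

(* Main.v *)
Require Import Defs.
From HB Require Import structures.
From mathcomp Require Import all_boot all_order all_algebra all_fingroup.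
From mathcomp Require Import all_solvable all_field.

Set Implicit Arguments.
Unset Strict Implicit.
Unset Printing Implicit Defensive.

Import GRing.Theory.
Local Open Scope ring_scope.

(* Embed the top L of the radical chain into a Galois extension M of K that
   contains a primitive N-th root of unity z, with N a common exponent of all
   radical steps.  Let F run through the fields K, K(z), K(z, a_1), ...,
   K(z, a_1, ..., a_n); each is normal with abelian group over the preceding
   one.  The compositum EF equals F for the last F, so its group over F is
   trivial there; going down the chain, Gal(EF / F) is a quotient of
   Gal(EF' / F), which is an extension of the abelian group Gal(F' / F) by
   Gal(EF' / F').  At F = K this is Gal(E / K).

   A polynomial over an abstract field need not have a computable irreducible
   factor, so M is only shown to exist classically (double negation); this is
   enough because solvability is a boolean. *)

(** * Descent of solvability along a tower of fields inside M *)

Section Compositum.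

Variables (K : fieldType) (charK : [pchar K] =i pred0).
Variable M : splittingFieldType K.
Implicit Types E F : {subfield M}.

Lemma pchar0_galois F E : (F <= E)%VS -> normalField F E -> galois F E.
Proof.
move=> sFE nFE; rewrite /galois sFE nFE andbT /=.
apply/separableP => x _; apply: pcharf0_separable => p.
by rewrite (pchar_lalg M) charK.
Qed.

Lemma normalField_prodv F E1 E2 :
  normalField F E1 -> normalField F E2 -> normalField F (E1 * E2)%AS.
Proof.
move=> /forall_inP n1 /forall_inP n2; apply/forall_inP => x Fx.
by rewrite /= aimgM (eqP (n1 x Fx)) (eqP (n2 x Fx)).
Qed.

(** Automorphisms preserve dimension, so the image of F(a) equals F(a) as soon as it is contained in
    it, and containment is decided at [a]. *)
Lemma normalField_adjoin F a :
  (forall x : 'AEnd(M), kHom F {:M} x -> x a \in <<F; a>>%VS) ->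
  normalField F <<F; a>>.
Proof.
move=> Fa; apply/forall_inP => x; rewrite inE kAutfE => homFx.
have dx : \dim (x @: <<F; a>>) = \dim <<F; a>>.
  by rewrite limg_dim_eq // (eqP (AEnd_lker0 x)) capv0.
rewrite eqEdim dx leqnn andbT aimg_adjoin.
have [_ /fixedSpace_limg->] := andP homFx.
by apply/FadjoinP; rewrite subv_adjoin Fa.
Qed.

Lemma solvable_gal_compositum F F' E :
    (F <= F')%VS -> normalField F F' -> abelian 'Gal(F' / F) ->
    normalField 1 E -> solvable 'Gal((E * F')%AS / F') ->
  solvable 'Gal((E * F)%AS / F).
Proof.
move=> sFF' nFF' abF' nE solEF'.
have nFE : normalField F E := normalFieldS (sub1v F) nE.
have sF'EF' : (F' <= (E * F')%AS)%VS := field_subvMl E F'.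
have galFEF' : galois F (E * F')%AS.
  by apply: pchar0_galois (subv_trans sFF' sF'EF') (normalField_prodv nFE nFF').
have solFEF' : solvable 'Gal((E * F')%AS / F).
  have sFF'E : (F <= F' <= (E * F')%AS)%VS by rewrite sFF'.
  rewrite (series_sol (normalField_normal sFF'E nFF')) solEF'.
  rewrite (isog_sol (normalField_isog galFEF' sFF'E nFF')).
  exact: abelian_sol.
have sFEF : (F <= (E * F)%AS <= (E * F')%AS)%VS.
  by rewrite field_subvMl prodvS.
have nFF : normalField F F.
  by apply/forall_inP=> x; rewrite inE kAutfE=> /andP[_ /fixedSpace_limg->].
rewrite -(isog_sol (normalField_isog galFEF' sFEF (normalField_prodv nFE nFF))).
exact: quotient_sol.
Qed.

(** Each element of Gal(F(a) / F) extends to an automorphism of M and is determined by its value at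
    [a]. Commutation at [a] of the automorphisms of M over F therefore makes this group abelian. *)
Lemma solvable_gal_compositum_adjoin F a E :
    (forall x : 'AEnd(M), kHom F {:M} x -> x a \in <<F; a>>%VS) ->
    (forall x y : 'AEnd(M), kHom F {:M} x -> kHom F {:M} y ->
       x (y a) = y (x a)) ->
    normalField 1 E -> solvable 'Gal((E * <<F; a>>)%AS / <<F; a>>) ->
  solvable 'Gal((E * F)%AS / F).
Proof.
move=> Fa Fcomm; have sFFa := subv_adjoin F a.
apply: solvable_gal_compositum => //; first exact: normalField_adjoin.
have gal_hom x : x \in 'Gal(<<F; a>> / F)%g ->
    exists2 g : 'AEnd(M), kHom F {:M} g & {in <<F; a>>%VS, x =1 g}.
  rewrite gal_kHom // => homx; have [g Dg] := kHom_to_AEnd homx.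
  exists g => //; apply/kAHomP => b Fb.
  by rewrite -Dg ?(subvP sFFa) //; case/kHomP_tmp: homx => ->.
apply/centsP => x Gx y Gy; apply/eqP.
rewrite (gal_adjoin_eq (groupM Gx Gy) (groupM Gy Gx)).
have [g homg Dx] := gal_hom x Gx; have [h homh Dy] := gal_hom y Gy.
have aFa := memv_adjoin F a.
rewrite !galM // (Dx a) // (Dy a) // (Dx (h a)) ?(Dy (g a)) ?Fa //.
by apply/eqP/Fcomm.
Qed.

(** Kummer case: an automorphism over F multiplies [a] by an N-th root of unity, which lies in F and
    so is fixed by the other automorphisms. *)
Lemma solvable_gal_radical N z F a E :
    N.-primitive_root z -> z \in F -> a ^+ N \in F ->
    normalField 1 E -> solvable 'Gal((E * <<F; a>>)%AS / <<F; a>>) ->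
  solvable 'Gal((E * F)%AS / F).
Proof.
move=> prim_z Fz FaN.
have hom_a (x : 'AEnd(M)) : kHom F {:M} x -> exists2 c, c \in F & x a = c * a.
  move=> homx; have [->|a0] := eqVneq a 0; first
    by exists 0; rewrite ?mem0v ?linear0 ?mul0r.
  have /(prim_rootP prim_z)[i Di] : (x a / a) ^+ N = 1.
    by rewrite expr_div_n -rmorphXn /= (kAHomP homx) // divff // expf_neq0.
  by exists (z ^+ i); [exact: rpredX | rewrite -Di divfK].
apply: solvable_gal_compositum_adjoin => [x /hom_a[c Fc ->]|x y homx homy].
  by rewrite rpredM ?memv_adjoin // subvP_adjoin.
have [[c Fc Dx] [d Fd Dy]] := (hom_a x homx, hom_a y homy).
rewrite Dx Dy !rmorphM /= Dx Dy (kAHomP homx) // (kAHomP homy) //.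
by rewrite mulrCA.
Qed.

(** Every automorphism sends [z] to a power of [z], and raising to powers commutes. *)
Lemma solvable_gal_cyclotomic N (z : M) F E :
    N.-primitive_root z ->
    normalField 1 E -> solvable 'Gal((E * <<F; z>>)%AS / <<F; z>>) ->
  solvable 'Gal((E * F)%AS / F).
Proof.
move=> prim_z.
have hom_z (x : 'AEnd(M)) : exists i, x z = z ^+ i.
  have /(prim_rootP prim_z)[i Di] : x z ^+ N = 1.
    by rewrite -rmorphXn /= (prim_expr_order prim_z) rmorph1.
  by exists i.
apply: solvable_gal_compositum_adjoin => [x _|x y _ _].
  by have [i ->] := hom_z x; rewrite rpredX ?memv_adjoin.
have [[i Dx] [j Dy]] := (hom_z x, hom_z y).
by rewrite Dx Dy !rmorphXn /= Dx Dy exprAC.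
Qed.

(** Induction on the length of the chain with F varying. F is only required to contain the image of
    [R 0], because it also contains [z]. *)
Lemma solvable_gal_radical_chain (L : fieldExtType K) (f : 'AHom(L, M)) n N z
    (R : nat -> {subfield L}) F E :
    N.-primitive_root z -> z \in F -> normalField 1 E ->
    (f @: R 0%N <= F)%VS -> (E <= f @: R n)%VS ->
    (forall i, (i < n)%N ->
       exists2 a, a ^+ N \in R i & R i.+1 = <<R i; a>>%AS) ->
  solvable 'Gal((E * F)%AS / F).
Proof.
move=> prim_z; elim: n R F => [|n IHn] R F Fz nE sRF sER stepR.
  have -> : (E * F)%AS = F.
    apply/val_inj/eqP; rewrite /= eqEsubv field_subvMl andbT prodv_sub //.
    exact: subv_trans sER sRF.
  have /trivgP-> : ('Gal(F / F) \subset [1])%g.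
    apply/subsetP=> x galx; rewrite inE; apply/gal_eqP=> b Fb.
    by rewrite gal_id (fixed_gal _ galx).
  exact: solvable1.
have [a RaN DR] := stepR 0%N isT.
apply: (@solvable_gal_radical N z F (f a)) => //.
  by rewrite -rmorphXn; apply: (subvP sRF); apply: memv_img.
(* Drop the first field of the chain and replace F by F(f(a)), which contains the image of [R 1]. *)
apply: (IHn (fun i => R i.+1)) => //; last by move=> i; apply: (stepR i.+1).
  exact: subvP_adjoin.
rewrite DR aimg_adjoin; apply/FadjoinP; rewrite memv_adjoin.
by rewrite (subv_trans sRF (subv_adjoin _ _)).
Qed.

End Compositum.

(** * Transport of normality and solvability along an embedding *)

Section Transfer.

Variables (K : fieldType) (E M : splittingFieldType K) (f : 'AHom(E, M)).

(** Minimal polynomials over K split in E, and [f] carries each factorization to its image. *)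
Lemma normalField_aimg : normalField 1 (f @: {:E})%AS.
Proof.
apply/normalFieldP => _ /memv_imgP[a _ ->].
have [r _ Da] := normalFieldP (normalFieldf 1%AS) a (memvf a).
exists (map f r).
  by apply/allP => _ /mapP[b _ ->]; apply: memv_img (memvf b).
transitivity (minPoly (f @: 1%AS)%VS (f a)); first by rewrite /= aimg1.
rewrite -map_minPoly Da big_map rmorph_prod.
by apply: eq_bigr => b _; rewrite rmorphB /= map_polyX map_polyC.
Qed.

(** Conjugation by [f] embeds Gal(E / K) into Gal(f(E) / K), and subgroups of solvable groups are
    solvable. *)
Lemma solvable_gal_aimg :
  solvable 'Gal((f @: {:E})%AS / 1%AS) -> solvable 'Gal({:E} / 1%AS).
Proof.
have fK : cancel f (f^-1)%VF by apply/lker0_lfunK/AHom_lker0.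
have conj_kAut (s : gal_of {:E}) :
    kAut 1 (f @: {:E})%AS (f \o s \o f^-1)%VF.
  rewrite kAutE k1HomE; apply/andP; split.
    apply/ahom_inP; split=> [_ _ /memv_imgP[a _ ->] /memv_imgP[b _ ->]|].
      by rewrite -rmorphM !comp_lfunE !fK !rmorphM.
    by rewrite -(rmorph1 f) !comp_lfunE fK !rmorph1.
  apply/subvP => _ /memv_imgP[_ /memv_imgP[a _ ->] ->].
  by rewrite !comp_lfunE memv_img ?memvf.
pose phi s := s2val (kAut_to_gal (conj_kAut s)).
have phi_gal s : phi s \in 'Gal((f @: {:E})%AS / 1%AS)%g.
  exact: s2valP (kAut_to_gal (conj_kAut s)).
have phiE s a : phi s (f a) = f (s a).
  rewrite -(s2valP' (kAut_to_gal (conj_kAut s))) ?memv_img ?memvf //.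
  by rewrite !comp_lfunE fK.
have phiM : {in 'Gal({:E} / 1%AS)%g &, {morph phi : s t / (s * t)%g}}.
  move=> s t _ _; apply/eqP/gal_eqP => _ /memv_imgP[a _ ->].
  by rewrite phiE !galM ?memv_img ?memvf // !phiE.
have injphi : ('injm (Morphism phiM))%g.
  apply/injmP => s t _ _ /= Dst; apply/eqP/gal_eqP => a _.
  by apply: (can_inj fK); rewrite -!phiE Dst.
rewrite -(injm_sol injphi (subxx _)); apply: solvableS.
by apply/subsetP => _ /morphimP[s _ _ ->]; apply: phi_gal.
Qed.

End Transfer.

(** * Classical existence of a normal extension with roots of unity *)

Lemma classically_irreducible_factor (F : fieldType) (p : {poly F}) :
    (1 < size p)%N ->
  classically (exists2 r, r %| p & irreducible_poly r).
Proof.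
have [n] := ubnP (size p); elim: n p => // n IHn p.
rewrite ltnS => le_p_n p_gt1.
move=> b Hb; pose P (q : {poly F}) := [/\ size q != 1, q %| p & ~~ (q %= p)].
(* The goal [b] is a boolean, so excluded middle is available: either [p] has a proper nonconstant
   divisor of smaller size, or [p] is itself irreducible. *)
apply: (@classic_EM (exists q, P q)) => -[[q [q1 q_p ne_qp]]|noP]; last first.
  apply: Hb; exists p => //; split=> // q q1 q_p.
  by apply: contraT => ne_qp; case: noP; exists q.
have nz_p : p != 0 by rewrite -size_poly_gt0 ltnW.
have lt_q_p : (size q < size p)%N.
  by rewrite ltn_neqAle dvdp_size_eqp // ne_qp dvdp_leq.
have q_gt1 : (1 < size q)%N.
  by rewrite ltn_neqAle eq_sym q1 size_poly_gt0 (dvdpN0 q_p).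
apply: (IHn q (leq_trans lt_q_p le_p_n) q_gt1) => -[r r_q irr_r].
by apply: Hb; exists r => //; apply: dvdp_trans r_q q_p.
Qed.

(** A ring morphism fixing K is K-linear, hence an algebra morphism. *)
Lemma ahom_of_rmorphism (K : fieldType) (L M : fieldExtType K)
    (g : {rmorphism L -> M}) :
  (forall c : K, g c%:A = c%:A) -> {f : 'AHom(L, M) | f =1 g}.
Proof.
move=> gK; have g_scalable : scalable g.
  by move=> c x; rewrite -mulr_algl rmorphM gK mulr_algl.
pose gZ := GRing.isScalable.Build K L M *:%R g g_scalable.
pose gL : {lrmorphism L -> M} := HB.pack (g : L -> M) g gZ.
by exists (linfun_ahom gL) => x; rewrite lfunE.
Qed.

(** Adjoin a root of an irreducible factor, divide out the linear factor and recurse on the size.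
    [L] varies in the induction; [baseFieldType] views an extension of [L] as one of K. *)
Lemma classically_splitting_extension (K : fieldType) (L : fieldExtType K)
    (p : {poly L}) :
    p != 0 ->
  classically (exists (M : fieldExtType K) (f : 'AHom(L, M)) (rs : seq M),
    map_poly f p %= \prod_(z <- rs) ('X - z%:P)).
Proof.
have [n] := ubnP (size p); elim: n L p => // n IHn L p le_p_n nz_p b Hb.
have [p_le1|p_gt1] := leqP (size p) 1.
  apply: Hb; exists L, \1%AF, [::].
  rewrite big_nil -size_poly_eq1 size_map_poly.
  by rewrite eqn_leq p_le1 size_poly_gt0.
apply: (classically_irreducible_factor p_gt1) => -[r r_p irr_r].
have [M1 _ [x rx0 _]] := irredp_FAdjoin irr_r.
have [c|f Df] := @ahom_of_rmorphism K L (baseFieldType M1) (in_alg M1).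
  by rewrite /= baseField_scaleE.
have : root (map_poly f p) (x : baseFieldType M1).
  rewrite (eq_map_poly Df) -(divpK r_p) rmorphM rootM.
  by apply/orP; right.
case/factor_theorem=> q Dp.
have szp : size p = size (q * ('X - x%:P)) by rewrite -Dp size_map_poly.
have nz_q : q != 0.
  by move: nz_p; rewrite -size_poly_eq0 szp size_poly_eq0 mulf_eq0 => /norP[].
have lt_q_n : (size q < n)%N.
  by rewrite szp size_mul ?polyXsubC_eq0 ?size_XsubC ?addn2 in le_p_n.
apply: (IHn (baseFieldType M1) q lt_q_n nz_q) => -[M [g [zs Dq]]].
apply: Hb; exists M, (g \o f)%AF, (g x :: zs).
have -> : map_poly (g \o f)%AF p = map_poly g (map_poly f p).
  by rewrite -map_poly_comp; apply: eq_map_poly => a; rewrite lfunE.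
by rewrite Dp rmorphM /= map_polyXsubC big_cons mulrC eqp_mull.
Qed.

(** M is a splitting field over K of [q], the product of 'X^N - 1 and the minimal polynomials of a
    basis of L. *)
Lemma classically_normal_closure (K : fieldType) (L : fieldExtType K) N :
    N%:R != 0 :> K ->
  classically (exists (M : splittingFieldType K) (f : 'AHom(L, M)) (z : M),
    N.-primitive_root z).
Proof.
move=> nz_N b Hb.
pose X := vbasis {:L}; pose q := (\prod_(a <- X) minPoly 1 a) * ('X^N - 1).
have N_gt0 : (0 < N)%N by rewrite lt0n; apply: contraNneq nz_N => ->.
have Kq : q \is a polyOver 1%AS.
  rewrite rpredM ?rpredB ?rpredX ?polyOverX ?rpred1 //.
  by apply: rpred_prod => a _; apply: minPolyOver.
have mon_q : q \is monic.
  rewrite rpredM ?monicXnsubC //.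
  by apply: rpred_prod => a _; apply: monic_minPoly.
apply: (classically_splitting_extension (monic_neq0 mon_q)).
move=> -[M0 [f [rs Dq]]].
(* Adjoining to K the roots of q alone gives a normal extension of K; it still
   contains f(L), since every vector of the basis X of L is a root of q. *)
pose S := <<1 & rs>>%AS; pose M1 := subvs_of S.
have root_S y : root (map_poly f q) y -> y \in S.
  by rewrite (eqp_root Dq) root_prod_XsubC; apply: seqv_sub_adjoin.
have fS a : f a \in S.
  rewrite (coord_vbasis (memvf a)) linear_sum rpred_sum // => i _.
  rewrite linearZ memvZ // root_S // rmorphM rootM rmorph_prod /=.
  have Xi : X`_i \in X by rewrite mem_nth // size_tuple.
  by rewrite (big_rem _ Xi) /= rootM fmorph_root root_minPoly.
have [qK DqK] := polyOver1P Kq.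
pose p := map_poly (in_alg M1) qK.
have Dp : map_poly vsval p = map_poly f q.
  rewrite DqK -!map_poly_comp; apply: eq_map_poly => c /=.
  by rewrite rmorph_alg algid1.
have [zs Drs] : exists zs : seq M1, map vsval zs = rs.
  exists (map (vsproj S) rs); rewrite -map_comp map_id_in // => y ys_y.
  by rewrite /= vsprojK ?seqv_sub_adjoin.
have Dpzs : p %= \prod_(z <- zs) ('X - z%:P).
  rewrite -(eqp_map (vsval : {rmorphism M1 -> M0})) Dp.
  rewrite rmorph_prod (eq_bigr _ (fun z _ => map_polyXsubC _ z)).
  by rewrite -(big_map vsval xpredT (fun z => 'X - z%:P)) Drs.
have gen_zs : <<1 & zs>>%VS = fullv.
  pose g := linfun_ahom (vsval : {lrmorphism M1 -> M0}).
  apply/vspaceP => u; rewrite memvf.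
  have : val u \in (g @: <<1 & zs>>)%VS.
    rewrite aimg_adjoin_seq aimg1 (_ : map g zs = rs) ?(valP u) //.
    by rewrite -Drs; apply: eq_map => y; rewrite lfunE.
  by case/memv_imgP => v zs_v; rewrite lfunE => /val_inj->.
(* As f(L) lies in [S], the projection loses nothing: this is [f] with its codomain restricted to
   [M1]. *)
have homf : ahom_in {:L} (linfun (vsproj S \o f) : 'Hom(L, M1)).
  apply/ahom_inP; split=> [x y _ _|]; apply: val_inj; rewrite !lfunE /=.
    by rewrite !vsprojK // rmorphM.
  by rewrite vsprojK // rmorph1 algid1.
have ax : splitting_field_axiom M1.
  exists p; first exact: alg_polyOver.
  by exists zs.
pose M : splittingFieldType K :=
  HB.pack M1 (FieldExt_isSplittingField.Build K M1 ax).
pose pN : {poly M} := 'X^N - 1.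
have /dvdp_prod_XsubC[m DpN] : pN %| \prod_(z <- zs) ('X - z%:P).
  rewrite -(eqp_dvdr _ Dpzs) -(dvdp_map (vsval : {rmorphism M1 -> M0})) Dp.
  rewrite rmorphM dvdp_mull // !rmorphB /= !map_polyXn !rmorph1.
  exact: dvdpp.
apply: Hb; exists M, (AHom homf : 'AHom(L, M1)).
(* [ws] lists the roots of [pN]. As N is nonzero in K, [pN] is separable, so these are N distinct
   N-th roots of unity and one of them is primitive. *)
set ws := mask m zs in DpN.
have : has N.-primitive_root ws.
  apply: has_prim_root => //.
  - apply/allP => w ws_w; rewrite unity_rootE -subr_eq0.
    by move: ws_w; rewrite -root_prod_XsubC -(eqp_root DpN) /root !hornerE.
  - rewrite -separable_prod_XsubC -(eqp_separable DpN).
    rewrite separable_Xn_sub_1 //.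
    by rewrite -(rmorph_nat (in_alg M)) fmorph_eq0.
  - rewrite -ltnS -(size_prod_XsubC _ id) -(eqp_size DpN).
    by rewrite size_XnsubC.
by case/hasP => z _ prim_z; exists z.
Qed.

(** * A common exponent for the chain, and the conclusion *)

Lemma radical_chain_common_exponent (K : fieldType) (L : fieldExtType K) n
    (R : nat -> {subfield L}) :
    (forall i, (i < n)%N -> radical_step (R i) (R i.+1)) ->
  exists2 N, (0 < N)%N & forall i, (i < n)%N ->
    exists2 a, a ^+ N \in R i & R i.+1 = <<R i; a>>%AS.
Proof.
elim: n => [|n IHn] stepR; first by exists 1%N.
have [i lt_i_n|N N_gt0 stepN] := IHn; first exact/stepR/ltnW.
have [a [k [k_gt0 Rak DR]]] := stepR n (ltnSn n).
(* A multiple of an admissible exponent is admissible, so the product serves both the earlier steps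
   and the last one. *)
exists (N * k)%N; first by rewrite muln_gt0 N_gt0.
move=> i; rewrite ltnS leq_eqVlt => /predU1P[->|/stepN[c RcN DRi]].
  by exists a; rewrite // mulnC exprM rpredX.
by exists c; rewrite // exprM rpredX.
Qed.

Theorem theorem9p1 (K : fieldType) (charK : [pchar K] =i pred0)
    (P : {poly K}) (E : splittingFieldType K) (splitE : splitting_field P E)
    (radE : solvable_by_radicals E) :
  solvable 'Gal({:E} / 1%AS).
Proof.
have [L [n [R [pi [[R0 Rn stepR] piK]]]]] := radE.
have [N N_gt0 stepN] := radical_chain_common_exponent stepR.
have [g _] := ahom_of_rmorphism piK.
have nz_N : N%:R != 0 :> K by rewrite ((pcharf0P K).1 charK) -lt0n.
apply: (classically_normal_closure (L := L) nz_N) => -[M [f [z prim_z]]].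
apply: (@solvable_gal_aimg _ _ _ (f \o g)%AF).
set E' := ((f \o g)%AF @: _)%AS.
have nE' : normalField 1 E' := normalField_aimg _.
(* Writing E' as its compositum with K starts the descent at F = K; [z] is adjoined first, then the
   radicals. *)
have <- : (E' * 1)%AS = E' by apply: val_inj; rewrite /= prodv1.
apply: (solvable_gal_cyclotomic charK prim_z nE').
apply: (solvable_gal_radical_chain charK prim_z _ nE' _ _ stepN).
- exact: memv_adjoin.
- by rewrite R0 aimg1 sub1v.
- by rewrite Rn /= limg_comp; apply/limgS/subvf.
Qed.
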